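(* Let $\Lambda\subseteq\mathbb{R}^n$ be a lattice, let $v_1,\ldots,v_k\in\mathbb{R}^n$ be such that $v_i-v_j\notin\Lambda$ for all $1\le i<j\le k$, and let $V=\bigcup_{i=1}^k(v_i+\Lambda)$. Then, for every bounded measurable set $D\subseteq\mathbb{R}^n$, there exists a translation $z\in\mathbb{R}^n$ such that \[\#\left((z+\overline{D})\cap V\right)\geq\left\lfloor\frac{\operatorname{vol}(D)\cdot k}{\det(\Lambda)}\right\rfloor+1.\] Moreover, the inequality is best possible for any $V$; that is, for every such $V$ there exists a bounded measurable set $D\subseteq\mathbb{R}^n$ such that \[\max_{z\in\mathbb{R}^n}\#\left((z+\overline{D})\cap V\right)=\left\lfloor\frac{\operatorname{vol}(D)\cdot k}{\det(\Lambda)}\right\rfloor+1.\]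
   Context: A lattice is a discrete subgroup of $\mathbb{R}^n$, always assumed to be of full rank; writing $\Lambda=B\mathbb{Z}^n$ with a basis matrix $B\in\mathbb{R}^{n\times n}$, its determinant is $\det(\Lambda)=|\det(B)|$. Measurable means Lebesgue-measurable, $\operatorname{vol}(D)$ denotes the volume (Lebesgue measure) of $D$, and $\overline{D}$ its topological closure. $\#$ denotes cardinality, and $z+X=\{z+x : x\in X\}$. Here $k\ge 1$ and $n\ge 1$ are integers.
   Formalization: In the first part the set D is additionally assumed nonempty; for D empty the printed inequality would read 0 ≥ 1 and is false. *)

(* Defs.v *)
From HB Require Import structures.
From mathcomp Require Import all_boot all_order all_algebra.
From mathcomp Require Import all_classical all_reals all_analysis.

Set Implicit Arguments.
Unset Strict Implicit.
Unset Printing Implicit Defensive.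

Import Order.TTheory GRing.Theory Num.Theory.
Import numFieldNormedType.Exports.

Local Open Scope classical_set_scope.
Local Open Scope ring_scope.

(* Points of R^n are row vectors, so the columns of the usual basis matrix of
   a lattice appear here as the rows of B. *)

Definition is_lattice (R : realType) (n : nat) (L : set 'rV[R]_n) : Prop :=
  [/\ L 0 /\ (forall x y, L x -> L y -> L (x - y)),
      isolated L = L &
      exists2 B : 'M[R]_n, B \in unitmx & forall i, L (row i B)].

Definition is_basis (R : realType) (n : nat) (L : set 'rV[R]_n)
    (B : 'M[R]_n) : Prop :=
  B \in unitmx /\ L = [set map_mx intr c *m B | c in [set: 'rV[int]_n]].

(* Every lattice has a basis, and |det B| is the same for all of them, so the
   choice made by [get] is immaterial. *)
Definition lattice_det (R : realType) (n : nat) (L : set 'rV[R]_n) : R :=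
  `| \det (get [set B : 'M[R]_n | is_basis L B]) |.

Definition box (R : realType) (n : nat) (a b : 'rV[R]_n) : set 'rV[R]_n :=
  [set x | forall i, a 0 i < x 0 i <= b 0 i].

Definition box_volume (R : realType) (n : nat) (a b : 'rV[R]_n) : R :=
  \prod_(i < n) (b 0 i - a 0 i).

Definition box_cover (R : realType) (n : nat) (A : set 'rV[R]_n)
    (ab : nat -> 'rV[R]_n * 'rV[R]_n) : Prop :=
  (forall k i, (ab k).1 0 i <= (ab k).2 0 i) /\
  A `<=` \bigcup_k box (ab k).1 (ab k).2.

Definition lebesgue_outer (R : realType) (n : nat) (A : set 'rV[R]_n) : \bar R :=
  ereal_inf [set (\sum_(k <oo) (box_volume (ab k).1 (ab k).2)%:E)%E
            | ab in box_cover A].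

Definition lebesgue_measurable (R : realType) (n : nat) (A : set 'rV[R]_n) :
  Prop := (@lebesgue_outer R n).-caratheodory A.

(* Only meant for sets of finite measure: [fine] sends +oo to 0. *)
Definition vol (R : realType) (n : nat) (A : set 'rV[R]_n) : R :=
  fine (lebesgue_outer A).

Definition translate (R : realType) (n : nat) (z : 'rV[R]_n)
  (X : set 'rV[R]_n) : set 'rV[R]_n := [set z + x | x in X].

(* Main.v *)
(* Averaging.  Since [floor x + 1] is the least integer above [x], it suffices
   to show that if every translate of the nonempty compact set [A = closure D]
   meets [V] in at most [m] points then [vol A * k < m * det L].
   By compactness and periodicity the bound [m] persists for a small
   thickening of [A].  Cover [A] by the [N] cells of a fine cubical grid that
   meet it; these cells together with one more adjacent cell still lie in the
   thickening.  Counting pairs (point of [V] in a large region, cell) through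
   the grid translation that matches them gives
   [(N + 1) * d ^ n * k <= m * det L], provided that the parallelepiped
   [M * P], with [P] spanned by a basis [B] of [L], contains at most
   [(1 + o(1)) * |det B| * M ^ n / d ^ n] grid points.  This asymptotic bound
   is multiplicative in the matrix, so an LUP decomposition reduces it to
   triangular and permutation matrices, where it is a direct count.
   For the equality case a one-point set [D] suffices. *)

Require Import Defs.
From mathcomp Require Import all_boot all_order all_algebra.
From mathcomp Require Import all_classical all_reals all_analysis.
From mathcomp Require Import fingroup perm finmap zify ring lra.

Import Order.TTheory GRing.Theory Num.Theory.
Import numFieldNormedType.Exports.

Local Open Scope classical_set_scope.
Local Open Scope ring_scope.

Set Implicit Arguments.
Unset Strict Implicit.
Unset Printing Implicit Defensive.

(** * Upper density of the lattice spanned by an invertible matrix *)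

Lemma size_le_fibers (R : realType) (T U : eqType) (f : T -> U) (s : seq T)
    (X : R) :
  (forall h, (count (fun g => f g == h) s)%:R <= X) ->
  (size s)%:R <= (size (undup (map f s)))%:R * X.
Proof.
move=> fib; set H := undup _.
(* Only this inclusion is kept for the induction: it survives deleting the head of [H] together with
   its fibre. *)
have : {subset map f s <= H} by move=> h; rewrite mem_undup.
move: H => H; elim: H s fib => [|h H IH] s fib sub.
  case: s fib sub => [|x s] _ sub; first by rewrite mul0r.
  by have := sub _ (mem_head _ _).
rewrite -(count_predC (fun g => f g == h)) natrD /= -natr1 mulrDl mul1r addrC.
apply: lerD (fib h); rewrite -size_filter; apply: IH => [h'|u /mapP[g]].
  apply: le_trans (fib h'); rewrite ler_nat.
  by rewrite count_filter; apply: sub_count => g /andP[].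
rewrite mem_filter => /andP[/= gh gs] ->.
by have := sub _ (map_f f gs); rewrite inE (negPf gh).
Qed.

(* The lattice spanned by the rows of [C] has upper density at most
   [1 / |det C|], uniformly in the position [a] of the counting cube. *)
Definition density_le (R : realType) (n : nat) (C : 'M[R]_n) : Prop :=
  forall e : R, 0 < e -> exists2 T : R, 0 < T &
    forall (M : R) (a : 'rV[R]_n) (s : seq 'rV[int]_n), T <= M -> uniq s ->
      (forall g j, g \in s ->
        a 0 j <= (map_mx intr g *m C) 0 j < a 0 j + M) ->
      (size s)%:R * `|\det C| <= ((1 + e) * M) ^+ n.

(* The hypothesis says that the box with sides [w] packs along the lattice, so
   rounding to multiples of [w] is injective on it. *)
Lemma density_le_tile (R : realType) (n : nat) (C : 'M[R]_n) (w : 'I_n -> R) :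
  (forall j, 0 < w j) -> \prod_j w j = `|\det C| ->
  (forall d : 'rV[int]_n,
     (forall j, `|(map_mx intr d *m C) 0 j| < w j) -> d = 0) ->
  density_le C.
Proof.
move=> w_gt0 prodw sep e e_gt0.
(* For [M] above this threshold every side [w j] is at most [e * M]; the [+ 1] keeps the threshold
   positive when [n = 0]. *)
exists (\sum_j w j / e + 1).
  rewrite ltr_wpDl// sumr_ge0// => j _.
  by rewrite divr_ge0 ?ltW.
move=> M a s TM us sbox.
have wM j : w j <= e * M.
  rewrite mulrC -ler_pdivrMr//; apply: le_trans TM.
  rewrite (bigD1 j)//= -addrA lerDl addr_ge0// sumr_ge0// => i _.
  by rewrite divr_ge0 ?ltW.
pose K j := Num.truncn (M / w j).
pose x (g : 'rV[int]_n) j := ((map_mx intr g *m C) 0 j - a 0 j) / w j.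
pose f g : {dffun forall j : 'I_n, 'I_(K j).+1} :=
  [ffun j => inord (Num.truncn (x g j))].
have x_ge0 g j : g \in s -> 0 <= x g j.
  move=> gs; have /andP[ag _] := sbox g j gs.
  by rewrite divr_ge0 ?subr_ge0// ltW.
have xK g j : g \in s -> (Num.truncn (x g j) < (K j).+1)%N.
  move=> gs; rewrite ltnS le_truncn// ler_pM2r ?invr_gt0//.
  by have /andP[_ /ltW] := sbox g j gs; rewrite lerBlDl.
have finj : {in s &, injective f}.
  move=> g h gs hs fgh; apply/eqP; rewrite -subr_eq0; apply/eqP/sep => j.
  have := congr1 (fun q : {dffun forall j : 'I_n, 'I_(K j).+1} => val (q j))
    fgh.
  rewrite /= !ffunE !inordK ?xK// => tgh.
  have /truncn_itv/andP[g1 g2] := x_ge0 g j gs.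
  have /truncn_itv/andP[h1 h2] := x_ge0 h j hs.
  have -> : (map_mx intr (g - h) *m C) 0 j = (x g j - x h j) * w j.
    rewrite map_mxB mulmxBl !mxE /x -mulrBl divfK ?gt_eqF// !mxE; ring.
  rewrite normrM (gtr0_norm (w_gt0 j)) -[ltRHS]mul1r ltr_pM2r//.
  rewrite tgh in g1 g2; rewrite -natr1 in g2; rewrite -natr1 in h2.
  by rewrite ltr_norml; apply/andP; split; lra.
have sK : (size s <= \prod_j (K j).+1)%N.
  have -> : (\prod_j (K j).+1)%N = #|{: {dffun forall j : 'I_n, 'I_(K j).+1}}|.
    rewrite card_dep_ffun foldrE big_map big_enum/=.
    by apply: eq_bigr => j _; rewrite card_ord.
  rewrite -(size_map f) -(card_uniqP _) ?map_inj_in_uniq//.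
  exact: max_card.
rewrite -prodw.
apply: (@le_trans _ _ ((\prod_j (K j).+1)%:R * \prod_j w j)).
  by rewrite ler_wpM2r ?ler_nat// prodr_ge0// => j _; exact: ltW.
rewrite natr_prod -big_split/= -[X in _ ^+ X]card_ord -prodr_const.
(* Factorwise, [(K j + 1) * w j <= M + w j <= (1 + e) * M]. *)
apply: ler_prod => j _; rewrite mulr_ge0 ?ler0n ?(ltW (w_gt0 _))//=.
have M0 : 0 <= M / w j.
  apply: divr_ge0; last exact: ltW.
  apply: le_trans TM; rewrite addr_ge0// sumr_ge0// => i _.
  by rewrite divr_ge0 ?ltW.
have /andP[KM _] := truncn_itv M0.
rewrite -natr1 mulrDl mul1r [leRHS]mulrDl mul1r lerD//.
by rewrite -ler_pdivlMr.
Qed.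

(* A lattice point [g C1] is rounded to the cubical grid of side [h]; each grid
   cube holds few points [g C1], and few grid points land in the image box
   under [C2]. *)
Lemma density_leM (R : realType) (n : nat) (C1 C2 : 'M[R]_n) :
  density_le C1 -> density_le C2 -> density_le (C1 *m C2).
Proof.
move=> d1 d2 e e_gt0.
(* For [0 < t <= 1] one has [(1 + t) ^ 3 <= 1 + 7 * t]; the three factors come from [d1], from [d2]
   and from enlarging the box. *)
pose e' := Num.min 1 (e / 7).
have e'_gt0 : 0 < e' by rewrite lt_min ltr01 divr_gt0.
have e'1 : e' <= 1 by rewrite ge_min lexx.
have e'e : e' <= e / 7 by rewrite ge_min lexx orbT.
have e'3 : (1 + e') * ((1 + e') * (1 + e')) <= 1 + e.
  move: (e') e'_gt0 e'1 e'e => t *; nra.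
(* The grid side [h] is the threshold for [C1] itself, so [d1] applies to a single grid cube. *)
have [h h_gt0 {}d1] := d1 _ e'_gt0; have [T T_gt0 {}d2] := d2 _ e'_gt0.
pose c := \sum_i \sum_j `|C2 i j|.
have c_ge0 : 0 <= c by apply: sumr_ge0 => i _; apply: sumr_ge0.
(* The first term gives [T <= M / h], the second makes the enlargement [2 * h * c] at most
   [e' * M]. *)
exists (h * T + 2 * h * c / e').
  by rewrite ltr_pwDl ?mulr_gt0// divr_ge0 ?mulr_ge0// ltW.
move=> M a s TM us sbox.
have hT : h * T <= M.
  by apply: le_trans TM; rewrite lerDl divr_ge0 ?mulr_ge0// ltW.
have hc : 2 * h * c <= e' * M.
  rewrite mulrC [e' * M]mulrC mulrC -ler_pdivrMr//; apply: le_trans TM.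
  by rewrite lerDr mulr_ge0// ltW.
have M_gt0 : 0 < M by apply: lt_le_trans hT; rewrite mulr_gt0.
pose cell (g : 'rV[int]_n) : 'rV[int]_n :=
  \row_j Num.floor ((map_mx intr g *m C1) 0 j / h).
pose r (g : 'rV[int]_n) : 'rV[R]_n :=
  map_mx intr g *m C1 - h *: map_mx intr (cell g).
have r_itv g j : 0 <= r g 0 j < h.
  rewrite /r !mxE -/((map_mx intr g *m C1) 0 j).
  have -> : \sum_k map_mx intr g 0 k * C1 k j = (map_mx intr g *m C1) 0 j.
    by rewrite !mxE.
  set y := (_ *m _) 0 j; have /andP[f1 f2] := floor_itv (y / h).
  rewrite intrD1 in f2; rewrite ler_pdivlMr// in f1.
  rewrite ltr_pdivrMr// in f2.
  by rewrite subr_ge0 ltrBlDr; apply/andP; split; lra.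
have rC g j : `|(r g *m C2) 0 j| <= h * c.
  rewrite mxE; apply: le_trans (ler_norm_sum _ _ _) _.
  rewrite mulr_sumr; apply: ler_sum => i _; rewrite normrM.
  have /andP[r0 /ltW rh] := r_itv g i.
  apply: ler_pM => //; first by rewrite ger0_norm.
  by rewrite (bigD1 j)//= lerDl sumr_ge0.
have gE g j : (map_mx intr g *m (C1 *m C2)) 0 j =
    h * (map_mx intr (cell g) *m C2) 0 j + (r g *m C2) 0 j.
  by rewrite mulmxA /r mulmxBl -scalemxAl !mxE; ring.
have fib q : (count (fun g => cell g == q) s)%:R * `|\det C1| <=
    ((1 + e') * h) ^+ n.
  rewrite -size_filter; apply: (d1 h (h *: map_mx intr q)) => //.
    exact: filter_uniq.
  move=> g j; rewrite mem_filter => /andP[/eqP <- _].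
  have := r_itv g j; rewrite /r.
  move: (map_mx intr g *m C1) => y; rewrite !mxE.
  by rewrite subr_ge0 ltrBlDr addrC.
(* Rounding moves the image under [C2] by at most [h * c] per coordinate; the box is enlarged by
   that on both sides and scaled by [1 / h]. *)
have size2 : (size (undup (map cell s)))%:R * `|\det C2| <=
    ((1 + e') * ((M + 2 * h * c) / h)) ^+ n.
  apply: (d2 _ (h^-1 *: (a - const_mx (h * c)))).
  - rewrite ler_pdivlMr// mulrC; apply: le_trans hT _.
    by rewrite lerDl !mulr_ge0// ltW.
  - exact: undup_uniq.
  - move=> q j; rewrite mem_undup => /mapP[g gs ->].
    have := sbox g j gs; rewrite gE.
    have := rC g j.
    have -> : (h^-1 *: (a - const_mx (h * c))) 0 j = (a 0 j - h * c) / h.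
      by rewrite !mxE mulrC.
    move: ((r g *m C2) 0 j) ((map_mx intr (cell g) *m C2) 0 j) => u v.
    rewrite ler_norml => /andP[u1 u2] /andP[v1 v2].
    rewrite -mulrDl ler_pdivrMr// ltr_pdivlMr//.
    by apply/andP; split; lra.
rewrite det_mulmx normrM.
have [->|D1] := eqVneq (\det C1) 0.
  rewrite normr0 mul0r mulr0 exprn_ge0// mulr_ge0 ?ltW//; lra.
have {}D1 : 0 < `|\det C1| by rewrite normr_gt0.
have := @size_le_fibers R _ _ cell s (((1 + e') * h) ^+ n / `|\det C1|).
move=> /(_ (fun q => _)) sz.
have {}sz : (size s)%:R * `|\det C1| <=
    (size (undup (map cell s)))%:R * ((1 + e') * h) ^+ n.
  rewrite -ler_pdivlMr// -mulrA; apply: sz => q.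
  by rewrite ler_pdivlMr.
rewrite mulrA.
apply: le_trans (ler_wpM2r _ sz) _ => //.
rewrite mulrAC.
apply: le_trans (ler_wpM2r _ size2) _.
  by rewrite exprn_ge0// mulr_ge0 ?ltW//; lra.
rewrite -exprMn lerXn2r ?nnegrE//.
- by rewrite !(mulr_ge0, addr_ge0)// ?invr_ge0 ltW.
- by rewrite mulr_ge0// ?ltW//; lra.
have -> : (1 + e') * ((M + 2 * h * c) / h) * ((1 + e') * h) =
   ((1 + e') * (1 + e')) * (M + 2 * h * c).
  by field; rewrite gt_eqF.
apply: le_trans (ler_wpM2r (ltW M_gt0) e'3).
have -> : (1 + e') * ((1 + e') * (1 + e')) * M =
  (1 + e') * (1 + e') * ((1 + e') * M) by ring.
by rewrite ler_wpM2l//; [apply: mulr_ge0; lra | lra].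
Qed.

(** Each factor of an LUP decomposition has a box that packs along its lattice: the unit cube for
    the permutation and the unit lower triangular factor, and the box with sides [|U j j|] for the
    upper triangular one. *)
Lemma density_le_unit (R : realType) (n : nat) (C : 'M[R]_n.+1) :
  C \in unitmx -> density_le C.
Proof.
move=> uC.
have := cormen_lup_perm C; have := cormen_lup_correct C.
have := cormen_lup_detL C; have := cormen_lup_lower C.
have := cormen_lup_upper C.
case: cormen_lup => -[P L] U /= Uup Llow Ldet PCLU Pperm.
have [s PE] := is_perm_mxP _ Pperm.
have {}PCLU : perm_mx s *m C = L *m U by rewrite -PE.
have uL : L \in unitmx by rewrite unitmxE Ldet unitr1.
have CE : C = perm_mx s^-1%g *m (L *m U).
  by rewrite -PCLU mulmxA -perm_mxM mulVg perm_mx1 mul1mx.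
have uU : U \in unitmx.
  by move: uC; rewrite CE !unitmx_mul => /andP[_ /andP[]].
have detU : \det U = \prod_i U i i.
  rewrite -det_tr det_trig; first by apply: eq_bigr => i _; rewrite mxE.
  by apply/is_trig_mxP => i j ij; rewrite mxE Uup.
have Uii i : U i i != 0.
  by move: uU; rewrite unitmxE unitfE detU => /prodf_neq0; apply.
have intr_lt1 (z : int) : `|z%:~R : R| < 1 -> z = 0.
  rewrite -intr_norm -[ltRHS]/(1%:~R) ltr_int => z1.
  by apply/eqP; rewrite -normr_eq0; lia.
rewrite CE; apply: density_leM; [|apply: density_leM].
- apply: (density_le_tile (w := fun=> 1)) => // [|d dP].
    by rewrite big1// det_perm normrX normrN1 expr1n.
  apply/rowP => j; rewrite mxE; apply: intr_lt1.
  have := dP (s^-1%g j); rewrite -[map_mx _ _ *m _]/(_ *m _) -col_permE !mxE.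
  by rewrite ?invgK ?permK ?permKV.
- apply: (density_le_tile (w := fun=> 1)) => // [|d dL].
    by rewrite big1// Ldet normr1.
  apply/rowP => j; rewrite mxE.
  (* Coordinate [j] of [d *m L] involves only the [d i] with [i >= j], so the entries of [d] vanish
     from the last to the first; for [U] below the order is reversed. *)
  have [m] := ubnP (n - j); elim: m j => // m IH j; rewrite ltnS => nj.
  apply: intr_lt1; have := dL j; rewrite mxE (bigD1 j)//= big1 ?addr0.
    by rewrite Llow// eqxx mulr1 mxE.
  move=> i ij; have [lt_ij|le_ji] := ltnP i j.
    by rewrite Llow 1?ltnW// -val_eqE (ltn_eqF lt_ij) mulr0.
  rewrite mxE IH ?mul0r//; have := ltn_ord i.
  by move: ij; rewrite -val_eqE /=; lia.
- apply: (density_le_tile (w := fun j => `|U j j|)) => [j||d dU].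
  + by rewrite normr_gt0.
  + by rewrite detU normr_prod.
  apply/rowP => j; rewrite mxE.
  have [m] := ubnP (j : nat); elim: m j => // m IH j; rewrite ltnS => jm.
  apply: intr_lt1; have := dU j; rewrite mxE (bigD1 j)//= big1 ?addr0.
    by rewrite normrM gtr_pMl ?normr_gt0// mxE.
  move=> i ij; have [lt_ij|le_ji] := ltnP i j.
    by rewrite mxE IH ?mul0r//; apply: leq_trans jm.
  by rewrite Uup ?mulr0// ltn_neqAle le_ji eq_sym val_eqE ij.
Qed.

(** * Discreteness of a lattice and existence of a basis *)

Lemma size_le_card_fset_set (T : choiceType) (A : set T) (s : seq T) :
  finite_set A -> uniq s -> (forall x, x \in s -> A x) ->
  (size s <= #|` fset_set A|)%N.
Proof.
move=> fA us sA; apply: uniq_leq_size => // x xs.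
by rewrite in_fset_set//; apply/mem_set/sA.
Qed.

Lemma coord_le_norm (R : realType) (n : nat) (x : 'rV[R]_n) (r : R) :
  0 <= r -> `|x| <= r <-> forall j, `|x 0 j| <= r.
Proof.
move=> r0; have -> : `|x| = mx_norm x by [].
rewrite mx_normrE; split=> [/bigmax_leP[_ xr] j|xr].
  by have := xr (0, j); exact.
by apply/bigmax_leP; split=> // -[i j] _ /=; rewrite ord1.
Qed.

Lemma lattice_separated (R : realType) (n : nat) (L : set 'rV[R]_n) :
  is_lattice L ->
  exists2 r : R, 0 < r & forall x, L x -> (forall j, `|x 0 j| < r) -> x = 0.
Proof.
move=> [[L0 _] isoL _].
have [_ [U /nbhs_ballP[r /= r0 rU] UL]] : isolated L 0 by rewrite isoL.
exists r => // x Lx xr; suff : (U `&` L) x by rewrite UL.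
split=> //; apply: rU; split=> // i j; rewrite ord1 !mxE.
by rewrite /ball/= sub0r normrN.
Qed.

(** Two lattice points in the same cell of side [r] differ by a lattice vector with all coordinates
    below [r], hence coincide; finitely many cells cover the region. *)
Lemma lattice_finite_bounded (R : realType) (n : nat) (L : set 'rV[R]_n)
    (K : R) :
  is_lattice L -> finite_set [set x | L x /\ forall j, `|x 0 j| <= K].
Proof.
move=> hL; have [r r0 Lr] := lattice_separated hL.
have [[_ LB] _ _] := hL.
pose N := Num.truncn ((K + K) / r).
pose f (x : 'rV[R]_n) : {ffun 'I_n -> 'I_N.+1} :=
  [ffun j => inord (Num.truncn ((x 0 j + K) / r))].
set S := [set x | _].
have finj : {in S &, injective f}.
  move=> x y /set_mem[Lx xK] /set_mem[Ly yK] fxy.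
  apply/eqP; rewrite -subr_eq0; apply/eqP/Lr => [|j]; first exact: LB.
  have := congr1 (fun k : {ffun 'I_n -> 'I_N.+1} => val (k j)) fxy.
  have bnd (z : 'rV[R]_n) : `|z 0 j| <= K -> 0 <= (z 0 j + K) / r /\
      (Num.truncn ((z 0 j + K) / r)%R < N.+1)%N.
    rewrite ler_norml => /andP[z1 z2]; split.
      by apply: divr_ge0; [lra | exact: ltW].
    by rewrite ltnS le_truncn// ler_pM2r ?invr_gt0//; lra.
  have [x0 xN] := bnd _ (xK j); have [y0 yN] := bnd _ (yK j).
  rewrite /= !ffunE !inordK// => txy.
  have /andP[x1 x2] := truncn_itv x0; have /andP[y1 y2] := truncn_itv y0.
  rewrite txy in x1 x2; rewrite -natr1 in x2; rewrite -natr1 in y2.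
  rewrite ler_pdivlMr// in x1; rewrite ltr_pdivrMr// in x2.
  rewrite ler_pdivlMr// in y1; rewrite ltr_pdivrMr// in y2.
  by rewrite !mxE ltr_norml; apply/andP; split; lra.
apply: card_le_finite (finite_finset (X := f @` S)).
by have := inj_card_eq finj; rewrite card_eq_le => /andP[].
Qed.

Lemma lattice_int_comb (R : realType) (n m : nat) (L : set 'rV[R]_n)
    (B : 'M[R]_(m, n)) (c : 'rV[int]_m) :
  is_lattice L -> (forall i, L (row i B)) -> L (map_mx intr c *m B).
Proof.
move=> [[L0 LB] _ _] BL.
have LN x : L x -> L (- x) by move=> Lx; rewrite -sub0r; exact: LB.
have LD x y : L x -> L y -> L (x + y).
  by move=> Lx Ly; rewrite -[y]opprK; apply: LB => //; exact: LN.
rewrite mulmx_sum_row; elim/big_ind: _ => // i _; rewrite mxE.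
have nat_L (k : nat) : L (k%:R *: row i B).
  elim: k => [|k IH]; first by rewrite scale0r.
  by rewrite -natr1 scalerDl scale1r; exact: LD.
case: (c 0 i) => k; first exact: nat_L.
by rewrite NegzE mulrNz scaleNr; apply: LN; exact: nat_L.
Qed.

Lemma norm_sub_floor_le (R : realType) (n : nat) (B : 'M[R]_n) (x : 'rV[R]_n)
    (j : 'I_n) :
  B \in unitmx ->
  `|(x - map_mx intr (map_mx Num.floor (x *m invmx B)) *m B) 0 j|
    <= \sum_i \sum_l `|B i l|.
Proof.
move=> uB; set y := x *m invmx B.
have -> : x - map_mx intr (map_mx Num.floor y) *m B =
    (y - map_mx intr (map_mx Num.floor y)) *m B.
  by rewrite mulmxBl mulmxKV.
move: y => y; rewrite mxE; apply: le_trans (ler_norm_sum _ _ _) _.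
apply: ler_sum => i _; rewrite normrM.
apply: (@le_trans _ _ `|B i j|); last first.
  by rewrite (bigD1 j)//= lerDl sumr_ge0.
rewrite ler_piMl// !mxE.
have /andP[] := floor_itv (y 0 i); rewrite intrD1 => y1 y2.
by rewrite ler_norml; apply/andP; split; lra.
Qed.

(** Reduced modulo the rows of [B], all multiples of [x] fall into one finite set of [Q] lattice
    points. Two of the first [Q + 1] multiples agree there, so some [(j - i) x] with
    [0 < j - i <= Q] is an integer combination; [N = Q!] serves all [x] at once. *)
Lemma lattice_multiple (R : realType) (n : nat) (L : set 'rV[R]_n)
    (B : 'M[R]_n) :
  is_lattice L -> B \in unitmx -> (forall i, L (row i B)) ->
  exists2 N : nat, (0 < N)%N &
    forall x, L x -> exists c : 'rV[int]_n, x *+ N = map_mx intr c *m B.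
Proof.
move=> hL uB BL; have [[L0 LB] _ _] := hL.
pose fl (x : 'rV[R]_n) : 'rV[int]_n := map_mx Num.floor (x *m invmx B).
pose fr (x : 'rV[R]_n) := x - map_mx intr (fl x) *m B.
pose K := \sum_i \sum_j `|B i j|.
have frK x j : `|fr x 0 j| <= K by exact: norm_sub_floor_le.
have LM x m : L x -> L (x *+ m).
  move=> Lx; elim: m => [|m IH]; first by rewrite mulr0n.
  rewrite mulrSr -[X in _ + X]opprK; apply: (LB) => //.
  by rewrite -sub0r; apply: LB.
have frL x : L x -> L (fr x).
  by move=> Lx; apply: LB => //; exact: lattice_int_comb.
have fin := @lattice_finite_bounded R n L K hL.
set Q := #|` fset_set [set x | L x /\ forall j, `|x 0 j| <= K]|.
exists Q`!; first exact: fact_gt0.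
move=> x Lx; pose s := [seq fr (x *+ j) | j <- iota 0 Q.+1].
have sQ : size s = Q.+1 by rewrite size_map size_iota.
have /(uniqPn 0)[i [j [ij jQ]]] : ~~ uniq s.
  apply/negP => us; suff : (Q.+1 <= Q)%N by rewrite ltnn.
  rewrite -{1}sQ; apply: size_le_card_fset_set => // _ /mapP[m _ ->].
  by split=> //; apply: frL; exact: LM.
rewrite sQ in jQ; rewrite !(nth_map 0%N) ?size_iota ?(ltn_trans ij)//.
rewrite !nth_iota ?(ltn_trans ij)//.
rewrite !add0n => frE.
have xE : x *+ (j - i) = map_mx intr (fl (x *+ j) - fl (x *+ i)) *m B.
  rewrite mulrnBr 1?ltnW// map_mxB mulmxBl.
  suff exch (a b c d : 'rV[R]_n) : a - b = c - d -> c - a = d - b.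
    exact: exch frE.
  move=> /eqP; rewrite subr_eq => /eqP ->.
  by rewrite !opprD opprK !addrA subrr add0r.
have /dvdnP[q ->] : (j - i %| Q`!)%N.
  by apply: dvdn_fact; rewrite subn_gt0 ij/=; lia.
exists ((fl (x *+ j) - fl (x *+ i)) *+ q).
rewrite mulnC mulrnA xE -scaler_nat scalemxAl; congr (_ *m B).
by apply/rowP => l; rewrite mxE mxE [RHS]mxE mulmxnE rmorphMn/= mulr_natl.
Qed.

(* A full-rank matrix [B] of lattice vectors with [|det B|] minimal is a basis:
   a lattice vector with a non-integral coordinate, reduced modulo the rows of
   [B] and put in the place of the corresponding row, would give a smaller
   determinant.  The minimum exists because [N * L] lies in the span of [B0]. *)
Lemma lattice_basis (R : realType) (n : nat) (L : set 'rV[R]_n) :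
  is_lattice L -> exists B : 'M[R]_n, is_basis L B.
Proof.
move=> hL; have [[L0 LB] _ [B0 uB0 B0L]] := hL.
have [N N_gt0 LN] := lattice_multiple hL uB0 B0L.
pose u := `|\det B0| / N%:R ^+ n.
have u_gt0 : 0 < u.
  rewrite divr_gt0 ?exprn_gt0 ?ltr0n// normr_gt0.
  by rewrite -unitfE -unitmxE.
(* The values of [|det B|] are natural multiples of the fixed [u > 0], because [N B = G B0] with [G]
   integral; hence a least positive one exists. *)
have detE (B : 'M[R]_n) : (forall i, L (row i B)) ->
    exists d : nat, `|\det B| = d%:R * u.
  move=> BL; have /choice[g gE] i := LN _ (BL i).
  pose G : 'M[int]_n := \matrix_i g i.
  have NB : N%:R *: B = map_mx intr G *m B0.
    apply/row_matrixP => i; rewrite row_mul -map_row rowK -gE.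
    by rewrite linearZ/= scaler_nat.
  exists `|\det G|%N; rewrite /u mulrA.
  apply: (canRL (mulfK _)); first by rewrite expf_neq0// pnatr_eq0 -lt0n.
  have := congr1 (fun X => `|\det X|) NB.
  rewrite detZ det_mulmx det_map_mx !normrM normrX normr_nat mulrC => ->.
  by rewrite -intr_norm -abszE.
pose P d := `[< exists2 B : 'M[R]_n, B \in unitmx /\ (forall i, L (row i B)) &
   `|\det B| = d%:R * u >].
have exP : exists d, P d.
  by have [d dE] := detE _ B0L; exists d; apply/asboolP; exists B0.
case: (ex_minnP exP) => d /asboolP[B [uB BL] dE] dmin.
exists B; split=> //; apply/seteqP; split=> [x Lx|_ [c _ <-]]; last first.
  exact: lattice_int_comb.
pose c := x *m invmx B; pose fl : 'rV[int]_n := map_mx Num.floor c.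
pose t := c - map_mx intr fl.
have xE : x = c *m B by rewrite mulmxKV.
have [t0|] := eqVneq t 0.
  exists fl => //; rewrite xE; congr (_ *m B).
  by apply/eqP; rewrite eq_sym -subr_eq0; apply/eqP.
case/rV0Pn => i ti0.
have t_itv : 0 < t 0 i < 1.
  have tiE : t 0 i = c 0 i - (Num.floor (c 0 i))%:~R.
    by rewrite mxE; congr (_ + _); rewrite mxE; congr (- _); rewrite 2!mxE.
  rewrite lt_neqAle eq_sym ti0/= tiE.
  by rewrite subr_ge0 floor_le/= ltrBlDr addrC -intrD1 floorD1_gt.
(* The identity with row [i] replaced by [t]: [E *m B] is [B] with row [i] replaced by the reduction
   of [x], and its determinant is scaled by [t 0 i < 1]. *)
pose E : 'M[R]_n := \matrix_k (if k == i then t else delta_mx 0 k).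
have detEi : \det E = t 0 i.
  rewrite (expand_det_col E i) (bigD1 i)//= big1 ?addr0 => [|k ki].
    rewrite mxE eqxx /cofactor addnn -signr_odd odd_double mul1r.
    rewrite [X in \det X](_ : _ = 1%:M) ?det1 ?mulr1//.
    apply/matrixP => a b; rewrite !mxE eq_sym (negPf (neq_lift _ _)) !mxE/=.
    by rewrite eq_sym (inj_eq lift_inj).
  by rewrite mxE (negPf ki) mxE/= eq_sym (negPf ki) mul0r.
have EL k : L (row k (E *m B)).
  rewrite row_mul rowK; case: ifP => [_|_].
    rewrite /t mulmxBl -xE; apply: (LB) => //; exact: lattice_int_comb.
  by rewrite -rowE.
have uE : E *m B \in unitmx.
  rewrite unitmx_mul uB andbT unitmxE detEi unitfE.
  by case/andP: t_itv => /lt0r_neq0.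
have [d' d'E] := detE _ EL.
have := dmin d'; rewrite leqNgt => /(_ _)/negP[].
  by apply/asboolP; exists (E *m B).
have /andP[t0 t1] := t_itv.
have dB : 0 < d%:R * u.
  by rewrite -dE normr_gt0 -unitfE -unitmxE.
rewrite -(ltr_nat R) -(ltr_pM2r u_gt0) -d'E det_mulmx normrM detEi dE.
by rewrite gtr_pMl// gtr0_norm.
Qed.

(** * Double counting of points against grid cells *)

Lemma ler_mul_expr1D (R : realType) (N : nat) (x y : R) :
  0 <= y -> (forall e, 0 < e -> x <= y * (1 + e) ^+ N) -> x <= y.
Proof.
move=> y0 xy.
(* On [[0, 1]] the power exceeds 1 by at most a multiple of [e], so [e] can be sent to 0. *)
have [c c0 cN] : exists2 c : R, 0 <= c &
    forall e, 0 <= e <= 1 -> (1 + e) ^+ N <= 1 + c * e.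
  elim: {xy}N => [|N [c c0 IH]].
    by exists 0 => // e _; rewrite expr0 mul0r addr0.
  exists (1 + 2 * c) => [|e e01]; first lra.
  have := IH e e01; case/andP: e01 => e0 e1 cN.
  rewrite exprSr; apply: le_trans (ler_wpM2r _ cN) _; first lra.
  have ce : 0 <= c * e by exact: mulr_ge0.
  nra.
apply/ler_addgt0Pr => e e0.
have yc : 0 <= y * c by exact: mulr_ge0.
pose t := Num.min 1 (e / (y * c + 1)).
have t0 : 0 < t by rewrite lt_min ltr01 divr_gt0//; lra.
have t1 : t <= 1 by rewrite ge_min lexx.
have te : t <= e / (y * c + 1) by rewrite ge_min lexx orbT.
apply: le_trans (xy _ t0) _.
apply: le_trans (ler_wpM2l y0 (cN _ _)) _; first by rewrite (ltW t0).
rewrite ler_pdivlMr in te; last lra.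
nra.
Qed.

(* The grid cells are open on the left, like [box]. *)
Definition cell (R : realType) (n : nat) (d : R) (x : 'rV[R]_n) : 'rV[int]_n :=
  \row_j (Num.ceil (x 0 j / d) - 1).

Lemma cellP (R : realType) (n : nat) (d : R) (x : 'rV[R]_n) (h : 'rV[int]_n) :
  0 < d -> (forall j, d * (h 0 j)%:~R < x 0 j <= d * (h 0 j + 1)%:~R) <->
           cell d x = h.
Proof.
move=> d0; split=> [xh|<- j].
  apply/rowP => j; rewrite mxE; have /andP[h1 h2] := xh j.
  apply/eqP; rewrite subr_eq; apply/eqP/ceil_def; rewrite addrK.
  by rewrite ltr_pdivlMr// ler_pdivrMr// ![_ * d]mulrC h1.
rewrite mxE subrK; have := ceil_itv (x 0 j / d).
by rewrite ltr_pdivlMr// ler_pdivrMr// ![_ * d]mulrC.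
Qed.

(** The [k * M ^ N * size S] pairs of a point and a cell are sorted by the grid translation matching
    them. Each translation occurs at most [m] times, and the density bound limits the number of
    translations to about [M ^ N * |det B| / d ^ N]. *)
Lemma double_count (R : realType) (n k m : nat) (B : 'M[R]_n.+1)
    (v : 'I_k -> 'rV[R]_n.+1) (d : R) (S : seq 'rV[int]_n.+1) :
  B \in unitmx -> 0 < d -> uniq S ->
  (forall (i j : 'I_k) (c : 'rV[int]_n.+1),
     v i - v j = map_mx intr c *m B -> i = j) ->
  (forall (z : 'rV[int]_n.+1) (s : seq 'rV[R]_n.+1), uniq s ->
     (forall p, p \in s -> (exists i c, p = v i + map_mx intr c *m B) /\
                           cell d p - z \in S) -> (size s <= m)%N) ->
  (size S)%:R * d ^+ n.+1 * k%:R <= m%:R * `|\det B|.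
Proof.
move=> uB d0 uS vB count_le.
set N := n.+1.
have detB : 0 < `|\det B| by rewrite normr_gt0 -unitfE -unitmxE.
(* Multiplication by [C] gives the coordinates of the grid point [d * g] with respect to [B]. *)
pose C := d *: invmx B.
have detC : `|\det C| = d ^+ N / `|\det B|.
  by rewrite /C detZ det_inv normrM normfV normrX (gtr0_norm d0).
have uC : C \in unitmx.
  by rewrite unitmxE unitfE -normr_gt0 detC divr_gt0 ?exprn_gt0.
pose b := \sum_i \sum_j `|(invmx B) i j|.
(* [a] bounds the three sources of error: the shift [v i], the position of a point in its cell, and
   the offset of a cell of [S]. In the coordinates of [B] the error is at most [K]. *)
pose a := \sum_i \sum_j `|v i 0 j| + d +
  d * \sum_(s <- S) \sum_j `|(s 0 j)%:~R|.
pose K := a * b.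
have b0 : 0 <= b by apply: sumr_ge0 => i _; apply: sumr_ge0.
have a0 : 0 <= a.
  rewrite !addr_ge0 ?(ltW d0)//.
    by apply: sumr_ge0 => i _; apply: sumr_ge0.
  by rewrite mulr_ge0 ?(ltW d0)//; apply: sumr_ge0 => i _; apply: sumr_ge0.
have K0 : 0 <= K by exact: mulr_ge0.
(* One [(1 + e) ^ N] comes from the density bound, the other from absorbing the margin [2 * K] into
   [e * M]. *)
rewrite -ler_pdivrMr//; apply: (@ler_mul_expr1D _ (N + N)) => // e e0.
have [T T0 dens] := density_le_unit uC e0.
pose M := (Num.truncn (T + 2 * K / e)).+1.
have MT : T + 2 * K / e < M%:R.
  have /truncn_itv/andP[_ //] : 0 <= T + 2 * K / e.
  by rewrite addr_ge0 ?(ltW T0)// divr_ge0 ?(ltW e0)//; lra.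
have TM : T <= M%:R.
  by apply: le_trans (ltW MT); rewrite lerDl divr_ge0 ?(ltW e0)//; lra.
have KM : 2 * K <= e * M%:R.
  rewrite mulrC -[leRHS]mulrC -ler_pdivrMr// mulrC; apply: le_trans (ltW MT).
  by rewrite lerDr (ltW T0).
have M0 : 0 < M%:R :> R by rewrite ltr0n.
pose J := ('I_k * {ffun 'I_N -> 'I_M})%type.
pose crd (q : J) : 'rV[int]_N := \row_j (q.2 j : nat)%:Z.
pose pt (q : J) := v q.1 + map_mx intr (crd q) *m B.
have pt_inj : injective pt.
  move=> q q' /eqP; rewrite /pt -subr_eq0 opprD addrACA -mulmxBl -map_mxB.
  move=> qq'.
  have q1 : q.1 = q'.1.
    apply: (@vB _ _ (- (crd q - crd q'))); rewrite map_mxN mulNmx.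
    by apply/eqP; rewrite -addr_eq0.
  move: qq'; rewrite q1 subrr add0r => /eqP qq'.
  have {qq'} : map_mx intr (crd q - crd q') = 0 :> 'rV[R]_N.
    by rewrite -[LHS](mulmxK uB) qq' mul0mx.
  move=> /rowP cc; case: q q' q1 cc => [i f] [i' f'] /= -> cc; congr pair.
  apply/ffunP => j; apply: val_inj; have /eqP := cc j.
  by rewrite !mxE/= intr_eq0 subr_eq0 => /eqP[].
pose X := [seq (q, s) | q <- enum {: J}, s <- S].
(* The unique grid translation carrying cell [s] to the cell of the point. *)
pose z (x : J * 'rV[int]_N) := cell d (pt x.1) - x.2.
have sX : size X = (k * M ^ N * size S)%N.
  by rewrite size_allpairs -cardE card_prod card_ord card_ffun !card_ord.
(* Once [h] is fixed, the point determines the cell [s], so a fibre injects into the points counted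
   by [count_le]. *)
have fib h : (count (fun x => z x == h) X)%:R <= m%:R :> R.
  rewrite ler_nat -size_filter; set Y := [seq x <- X | z x == h].
  rewrite -(size_map (fun x => pt x.1)); apply: (count_le h).
    rewrite map_inj_in_uniq.
      by rewrite filter_uniq// allpairs_uniq ?enum_uniq// => -[? ?] [? ?].
    move=> [q s] [q' s']; rewrite !mem_filter /z/=.
    move=> /andP[/eqP E1 _] /andP[/eqP E2 _].
    move=> /pt_inj qq'; rewrite qq' in E1 *; congr pair.
    by apply: oppr_inj; apply: (addrI (cell d (pt q'))); rewrite E1 E2.
  move=> p /mapP[[q s]]; rewrite mem_filter /z/= => /andP[/eqP <- qs] ->.
  split; first by exists q.1, (crd q).
  rewrite opprB addrC subrK.
  by case/allpairsP: qs => -[q' s'] /= [_ s'S [_ ->]].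
have := size_le_fibers fib; set Z := undup _ => XZ.
have ZC : (size Z)%:R * `|\det C| <= ((1 + e) * (M%:R + 2 * K)) ^+ N.
  apply: (dens _ (const_mx (- K))); [lra | exact: undup_uniq |].
  move=> g j; rewrite mem_undup.
  move=> /mapP[[q s] /allpairsP[[q' s'] /= [_ sS [-> {q}-> {s}]]] ->].
  rewrite /z/=; set p := pt q'.
  pose y := p - d *: map_mx intr (cell d p).
  have y_itv l : `|y 0 l| <= d.
    have := iffRL (cellP p (cell d p) d0) erefl l.
    rewrite /y !mxE intrD ler_norml => /andP[? ?].
    by apply/andP; split; lra.
  (* The grid translation, in the coordinates of [B], is the integer point [crd q'] of [[0, M) ^ N]
     plus the error [w *m invmx B]. *)
  pose w := v q'.1 - y - d *: map_mx intr s'.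
  have -> : map_mx intr (cell d p - s') *m C =
      map_mx intr (crd q') + w *m invmx B.
    rewrite -[X in _ = X + _](mulmxK uB) -mulmxDl /C -scalemxAr scalemxAl.
    congr (_ *m _); rewrite /w /y /p /pt map_mxB.
    rewrite scalerBr; move: (d *: map_mx _ (cell _ _)) => x1.
    move: (d *: _) => x2; move: (map_mx _ _ *m B) => x3.
    by apply/rowP => l; rewrite !mxE; ring.
  have w_le l : `|w 0 l| <= a.
    have -> : w 0 l = v q'.1 0 l - y 0 l - d * (s' 0 l)%:~R by rewrite /w !mxE.
    apply: le_trans (ler_normB _ _) _; apply: lerD.
      apply: le_trans (ler_normB _ _) _; apply: lerD => //.
      rewrite (bigD1 q'.1)//= (bigD1 l)//= -addrA lerDl.
      rewrite addr_ge0 ?sumr_ge0// => i _.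
      exact: sumr_ge0.
    rewrite normrM (gtr0_norm d0) ler_pM2l// (big_rem s')//= (bigD1 l)//=.
    rewrite -addrA.
    by rewrite lerDl addr_ge0 ?sumr_ge0// => i _; exact: sumr_ge0.
  have wB : `|(w *m invmx B) 0 j| <= K.
    rewrite mxE; apply: le_trans (ler_norm_sum _ _ _) _.
    rewrite /K mulr_sumr; apply: ler_sum => i _; rewrite normrM.
    apply: ler_pM => //.
    by rewrite (bigD1 j)//= lerDl sumr_ge0.
  move: wB; rewrite ler_norml => /andP[w1 w2].
  have -> : (map_mx intr (crd q') + w *m invmx B) 0 j =
      (q'.2 j : nat)%:R + (w *m invmx B) 0 j by rewrite 3!mxE.
  have := ltn_ord (q'.2 j); rewrite -(ltr_nat R) => qM.
  have : 0 <= (q'.2 j : nat)%:R :> R by [].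
  by rewrite mxE => ?; apply/andP; split; lra.
move: XZ; rewrite sX !natrM natrX => XZ.
have {}XZ : k%:R * M%:R ^+ N * (size S)%:R * (d ^+ N / `|\det B|) <=
    m%:R * ((1 + e) * ((1 + e) * M%:R)) ^+ N.
  rewrite -detC; apply: le_trans (ler_wpM2r _ XZ) _ => //.
  rewrite mulrAC mulrC ler_wpM2l//; apply: le_trans ZC _.
  rewrite lerXn2r ?nnegrE//.
  - by rewrite mulr_ge0//; lra.
  - by rewrite !mulr_ge0//; lra.
  - by rewrite ler_pM2l; lra.
rewrite -(@ler_pM2r _ (M%:R ^+ N)) ?exprn_gt0//.
have -> : m%:R * (1 + e) ^+ (N + N) * M%:R ^+ N =
    m%:R * ((1 + e) * ((1 + e) * M%:R)) ^+ N.
  by rewrite !exprMn exprD; ring.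
apply: le_trans XZ; rewrite le_eqVlt; apply/orP; left; apply/eqP.
by field; rewrite gt_eqF.
Qed.

(** * Persistence of the counting bound under a small thickening *)

Lemma closed_separated_seq (R : realType) (n : nat) (A : set 'rV[R]_n)
    (s : seq 'rV[R]_n) :
  closed A -> exists2 r : R, 0 < r &
    forall p a, p \in s -> ~ A p -> A a -> r <= `|p - a|.
Proof.
move=> cA; elim: s => [|q s [r r0 IH]]; first by exists 1.
have [Aq|nAq] := pselect (A q).
  exists r => // p a; rewrite inE => /orP[/eqP->//|]; exact: IH.
have /nbhs_ballP[t /= t0 tA] : nbhs q (~` A).
  by apply: open_nbhs_nbhs; split=> //; exact: closed_openC.
exists (Num.min r t) => [|p a]; first by rewrite lt_min r0.
rewrite inE ge_min => /orP[/eqP-> _ Aa|ps nAp Aa]; last by rewrite (IH p a).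
apply/orP; right; rewrite leNgt; apply/negP => qa; apply: (tA a) => //.
by rewrite -ball_normE.
Qed.

(** Near a given [z] only finitely many points of [V] matter, and those with [p - z] outside [A]
    keep a positive distance from [A]; so a small thickening and a small move of [z] admit no new
    point. Compactness of [Q] makes the thickening uniform. *)
Lemma count_thickening (R : realType) (n m : nat) (A V Q : set 'rV[R]_n) :
  compact Q -> bounded_set Q -> closed A -> bounded_set A ->
  (forall K : R, finite_set [set p | V p /\ `|p| <= K]) ->
  (forall z s, uniq s -> (forall p, p \in s -> V p /\ A (p - z)) ->
     (size s <= m)%N) ->
  exists2 e : R, 0 < e &
    forall z s, Q z -> uniq s ->
      (forall p, p \in s -> V p /\ exists2 a, A a & `|p - z - a| <= e) ->
      (size s <= m)%N.
Proof.
move=> coQ [KQ [_ QK]] cA [KA [_ AK]] Vfin Vm.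
pose P (e : R) (z : 'rV[R]_n) := forall s, uniq s ->
  (forall p, p \in s -> V p /\ exists2 a, A a & `|p - z - a| <= e) ->
  (size s <= m)%N.
have PQ : \forall e \near (0 : R)^'+, Q `<=` P e.
  move/compact_near_coveringP : coQ; apply => z Qz.
  have zK : `|z| <= KQ + 1 by apply: QK => //; rewrite ltrDl.
  (* The radius is the sum of the bounds [KA + 1] for [a], [KQ + 1] for [z] and [2] for
     [p - z - a]. *)
  have /finite_seqP[W WE] := Vfin (KA + KQ + 4).
  have [r r0 rW] := closed_separated_seq [seq p - z | p <- W] cA.
  pose t := Num.min 1 (r / 2).
  have t0 : 0 < t by rewrite lt_min ltr01 divr_gt0.
  have [t1 tr] : t <= 1 /\ t <= r / 2 by rewrite !ge_min !lexx orbT.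
  exists (ball z t, [set e | e < t]); first split=> /=.
  - exact: nbhsx_ballx.
  - exact: nbhs_right_lt.
  case=> z' e /= [zz' et] s us sV; apply: (Vm z s us) => p ps.
  have [Vp [a Aa pa]] := sV p ps; split=> //.
  have {}zz' : `|z - z'| < t by move: zz'; rewrite -ball_normE.
  have paz : `|p - z - a| < t + t.
    have -> : p - z - a = (p - z' - a) - (z - z').
      by apply/rowP => l; rewrite !mxE; ring.
    by apply: le_lt_trans (ler_normB _ _) _; lra.
  have aK : `|a| <= KA + 1 by apply: AK => //; rewrite ltrDl.
  have pW : p \in W.
    suff : [set` W] p by [].
    rewrite -WE; split=> //.
    have -> : p = (p - z - a) + (z + a) by apply/rowP => l; rewrite !mxE; ring.
    have := ler_normD (p - z - a) (z + a); have := ler_normD z a; lra.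
  apply: contrapT => nA; have := rW (p - z) a (map_f _ pW) nA Aa; lra.
near (0 : R)^'+ => e; exists e; first by near: e; exact: nbhs_right_gt.
by move=> z s Qz; apply: (near PQ e) => //.
Unshelve. all: by end_near. Qed.

(** * Outer measure of finite unions of cells and of points *)

Lemma box_volume_ge0 (R : realType) (n : nat) (a b : 'rV[R]_n) :
  (forall j, a 0 j <= b 0 j) -> 0 <= box_volume a b.
Proof. by move=> ab; apply: prodr_ge0 => i _; rewrite subr_ge0. Qed.

Lemma lebesgue_outer_ge0 (R : realType) (n : nat) (X : set 'rV[R]_n) :
  (0 <= lebesgue_outer X)%E.
Proof.
apply: le_ereal_inf_tmp => _ [ab [ab_le _] <-].
by apply: nneseries_ge0 => k _ _; rewrite lee_fin box_volume_ge0.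
Qed.

Lemma le_lebesgue_outer (R : realType) (n : nat) (X Y : set 'rV[R]_n) :
  X `<=` Y -> (lebesgue_outer X <= lebesgue_outer Y)%E.
Proof.
move=> XY; apply: le_ereal_inf_tmp => _ [ab [ab_le cov] <-].
apply: ereal_inf_lbound; exists ab => //; split=> //.
exact: subset_trans cov.
Qed.

Lemma lebesgue_outer0 (R : realType) (n : nat) :
  lebesgue_outer (set0 : set 'rV[R]_n.+1) = 0%E.
Proof.
apply/eqP; rewrite eq_le lebesgue_outer_ge0 andbT.
(* The degenerate boxes have volume 0 because the dimension is positive; an empty product would be
   1. *)
apply: ereal_inf_lbound; exists (fun=> (0, 0)).
  by split=> // k i; rewrite mxE.
rewrite eseries0// => k _ _.
by rewrite /box_volume big_ord_recl mxE subrr mul0r.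
Qed.

(** A cover of the remainder becomes a cover of [X] when the box is put in front of it. *)
Lemma lebesgue_outer_setD_box (R : realType) (n : nat) (a b : 'rV[R]_n)
    (X : set 'rV[R]_n) :
  (forall j, a 0 j <= b 0 j) ->
  (lebesgue_outer X <= (box_volume a b)%:E + lebesgue_outer (X `\` box a b))%E.
Proof.
move=> ab; rewrite -leeBlDl//; apply: le_ereal_inf_tmp => _ [cd [cd_le cov] <-].
rewrite leeBlDl//.
apply: ereal_inf_lbound; exists (fun k => if k is k'.+1 then cd k' else (a, b)).
  split=> [[|k] i|x Xx]; [exact: ab | exact: cd_le |].
  have [xab|nxab] := pselect (box a b x); first by exists 0%N.
  by have [|k _ xk] := cov x; [split | exists k.+1].
rewrite nneseries_recl//; last first.
  by case=> [|k] _ /=; rewrite lee_fin box_volume_ge0.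
congr (_ + _)%E; rewrite -(@nneseries_addn _ _ 1%N); last first.
  by case=> [|k] /=; rewrite lee_fin box_volume_ge0.
by apply: eq_eseriesr => k _; rewrite addn1.
Qed.

Lemma lebesgue_outer_cells (R : realType) (n : nat) (d : R)
    (S : seq 'rV[int]_n.+1) (X : set 'rV[R]_n.+1) :
  0 < d -> (forall x, X x -> cell d x \in S) ->
  (lebesgue_outer X <= ((size S)%:R * d ^+ n.+1)%:E)%E.
Proof.
move=> d0; elim: S X => [|h S IH] X XS.
  have -> : X = set0 by apply/seteqP; split=> // x /XS.
  by rewrite lebesgue_outer0 lee_fin mul0r.
pose a : 'rV[R]_n.+1 := \row_j (d * (h 0 j)%:~R).
pose b : 'rV[R]_n.+1 := \row_j (d * (h 0 j + 1)%:~R).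
have ab j : a 0 j <= b 0 j by rewrite !mxE ler_pM2l// ler_int lerDl.
apply: le_trans (lebesgue_outer_setD_box _ ab) _.
have -> : box_volume a b = d ^+ n.+1.
  rewrite -[in RHS](card_ord n.+1) -prodr_const; apply: eq_bigr => i _.
  by rewrite !mxE intrD; ring.
rewrite [size (h :: S)]/= -natr1 mulrDl mul1r EFinD addeC; apply: leeD => //.
apply: IH => x [Xx nab].
have := XS x Xx; rewrite inE => /orP[/eqP xh|//].
by exfalso; apply: nab => i; rewrite !mxE; move/(cellP x h d0): xh => /(_ i).
Qed.

Lemma lebesgue_outer_setD1 (R : realType) (n : nat) (x : 'rV[R]_n.+1)
    (X : set 'rV[R]_n.+1) :
  (lebesgue_outer X <= lebesgue_outer (X `\ x))%E.
Proof.
apply/lee_addgt0Pr => e e0.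
(* The point is removed inside the box of side [d] having it as upper corner, whose volume satisfies
   [d ^ n.+1 <= d <= e]. *)
pose d := Num.min 1 e.
have d0 : 0 < d by rewrite lt_min ltr01.
have d1 : d <= 1 by rewrite ge_min lexx.
have de : d <= e by rewrite ge_min lexx orbT.
pose a : 'rV[R]_n.+1 := x - const_mx d.
have ab j : a 0 j <= x 0 j by rewrite !mxE; lra.
apply: le_trans (lebesgue_outer_setD_box _ ab) _; rewrite addeC; apply: leeD.
  apply: le_lebesgue_outer => y [Xy nab]; split=> // yx; apply: nab => i.
  by rewrite yx lexx andbT !mxE; lra.
have -> : box_volume a x = d ^+ n.+1.
  rewrite -[in RHS](card_ord n.+1) -prodr_const; apply: eq_bigr => i _.
  by rewrite !mxE; ring.
rewrite lee_fin; apply: le_trans de.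
by rewrite exprS ler_piMr ?(ltW d0)// exprn_ile1// ltW.
Qed.

Lemma lebesgue_outer1 (R : realType) (n : nat) (x : 'rV[R]_n.+1) :
  lebesgue_outer [set x] = 0%E.
Proof.
apply/eqP; rewrite eq_le lebesgue_outer_ge0 andbT.
by apply: le_trans (lebesgue_outer_setD1 x _) _; rewrite setDv lebesgue_outer0.
Qed.

Lemma lebesgue_measurable1 (R : realType) (n : nat) (x : 'rV[R]_n.+1) :
  lebesgue_measurable [set x].
Proof.
move=> X.
have -> : lebesgue_outer (X `&` [set x]) = 0%E.
  apply/eqP; rewrite eq_le lebesgue_outer_ge0 andbT -(lebesgue_outer1 x).
  by apply: le_lebesgue_outer => y [].
rewrite add0e -setDE; apply/eqP; rewrite eq_le lebesgue_outer_setD1/=.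
by apply: le_lebesgue_outer => y [].
Qed.

(** * Cardinalities, finiteness of the set of cells, reduction modulo the lattice *)

Lemma counting_set1 (R : realType) (T : choiceType) (x : T) :
  counting [set x] = 1%:E :> \bar R.
Proof.
by rewrite /counting asboolT ?fset_set1 ?cardfs1//; exact: finite_set1.
Qed.

(** An infinite [X] has counting value [+oo], which the first hypothesis excludes. *)
Lemma counting_not_ge (R : realType) (T : choiceType) (X : set T) (m : nat)
    (s : seq T) :
  ~ (m.+1%:R%:E <= counting X :> \bar R)%E ->
  uniq s -> (forall x, x \in s -> X x) -> (size s <= m)%N.
Proof.
rewrite /counting; case: asboolP => [fX|_]; last by rewrite leey.
rewrite lee_fin ler_nat => /negP; rewrite -leqNgt => Xm us sX.
exact: leq_trans (size_le_card_fset_set fX us sX) Xm.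
Qed.

Lemma finite_int_box (n : nat) (N : nat) :
  finite_set [set h : 'rV[int]_n | forall j, (`|h 0%R j| <= N)%N].
Proof.
pose f (g : {ffun 'I_n -> 'I_(N + N).+1}) : 'rV[int]_n :=
  \row_j ((g j : nat)%:Z - N%:Z).
apply: (@sub_finite_set _ _ (f @` setT)); last exact: finite_image.
move=> h hN; exists [ffun j => inord `|(h 0 j + N%:Z)%R|%N] => //.
apply/rowP => j; have := hN j; rewrite mxE ffunE => hj.
by rewrite inordK; lia.
Qed.

Lemma cell_finite (R : realType) (n : nat) (d : R) (A : set 'rV[R]_n) :
  0 < d -> bounded_set A -> finite_set (cell d @` A).
Proof.
move=> d0 [K [_ AK]].
pose N := (Num.truncn ((`|K| + 1) / d)).+1.
apply: sub_finite_set (finite_int_box n N.+1) => _ [a Aa <-] j /=.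
have aK : `|a 0 j| <= `|K| + 1.
  have := AK (`|K| + 1); rewrite (le_lt_trans (ler_norm K)) ?ltrDl//.
  move=> /(_ isT a Aa).
  by move/coord_le_norm; apply; rewrite addr_ge0.
have KN : (`|K| + 1) / d < N%:R.
  have /truncn_itv/andP[_ //] : 0 <= (`|K| + 1) / d.
  by rewrite divr_ge0 ?(ltW d0)// addr_ge0.
rewrite ltr_pdivrMr// in KN.
have /(_ j) := iffRL (cellP a (cell d a) d0) erefl.
move: (cell d a 0 j) => h; rewrite intrD => /andP[h1 h2].
move: aK; rewrite ler_norml => /andP[a1 a2].
have h3 : d * h%:~R < d * (N%:Z%:~R) by rewrite -[N%:Z%:~R]/(N%:R); lra.
have h4 : d * (- N%:Z)%:~R < d * (h + 1)%:~R.
  by rewrite intrN intrD -[N%:Z%:~R]/(N%:R); lra.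
rewrite ltr_pM2l// ltr_int in h3; rewrite ltr_pM2l// ltr_int in h4.
lia.
Qed.

Lemma lattice_reduction (R : realType) (n : nat) (L : set 'rV[R]_n) :
  is_lattice L -> exists2 K : R, 0 <= K &
    forall z, exists2 l, L l & forall j, `|(z - l) 0 j| <= K.
Proof.
move=> hL; have [_ _ [B uB BL]] := hL.
exists (\sum_i \sum_j `|B i j|).
  by apply: sumr_ge0 => i _; apply: sumr_ge0.
move=> z; exists (map_mx intr (map_mx Num.floor (z *m invmx B)) *m B) => [|j].
  exact: lattice_int_comb.
exact: norm_sub_floor_le.
Qed.

Lemma bounded_closure (R : realType) (n : nat) (D : set 'rV[R]_n) :
  bounded_set D -> bounded_set (closure D).
Proof.
move=> [K [_ DK]]; exists (K + 2); split; first exact: num_real.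
move=> M KM x /(_ (ball x 1) (nbhsx_ballx _ _ ltr01))[y [Dy]].
rewrite -ball_normE/= => xy.
have yK : `|y| <= K + 1 by apply: DK => //; rewrite ltrDl.
have -> : x = (x - y) + y by rewrite subrK.
by apply: le_trans (ler_normD _ _) _; lra.
Qed.

(** Otherwise [S] would contain all the distinct elements [h + u *+ k]. This provides the one extra
    adjacent cell that makes the volume bound strict. *)
Lemma exists_new_translate (T : zmodType) (S : seq T) (u h : T) :
  (forall k, u *+ k = 0 -> k = 0%N) -> h \in S ->
  exists2 g, g \in S & g + u \notin S.
Proof.
move=> u_free hS; apply: contrapT => noex.
have step g : g \in S -> g + u \in S.
  by move=> gS; apply: contrapT => /negP gu; apply: noex; exists g.
have mem k : h + u *+ k \in S.
  by elim: k => [|k IH]; rewrite ?addr0// mulrSr addrA step.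
pose t := [seq h + u *+ k | k <- iota 0 (size S).+1].
have ut : uniq t.
  rewrite map_inj_uniq ?iota_uniq// => i j /addrI.
  wlog ij : i j / (i <= j)%N.
    by move=> w; case/orP: (leq_total i j) => ij E; [exact: w | apply/esym/w].
  by move/eqP; rewrite eq_sym -subr_eq0 -mulrnBr// => /eqP/u_free; lia.
suff : (size t <= size S)%N by rewrite size_map size_iota ltnn.
by apply: uniq_leq_size => // _ /mapP[k _ ->].
Qed.

(** * Strict volume bound for a set whose translates meet [V] in at most [m] points *)

Section UnionOfTranslates.
Context (R : realType) (n k : nat).
Context (L : set 'rV[R]_n.+1) (v : 'I_k -> 'rV[R]_n.+1).
Hypothesis hk : (0 < k)%N.
Hypothesis hL : is_lattice L.
Hypothesis hv : forall i j : 'I_k, (i < j)%N -> ~ L (v i - v j).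
Let V := \bigcup_(i in [set: 'I_k]) translate (v i) L.

Lemma translates_finite_bounded (K : R) : finite_set [set p | V p /\ `|p| <= K].
Proof.
pose W (i : 'I_k) :=
  translate (v i) [set l | L l /\ forall j, `|l 0 j| <= `|K| + `|v i|].
apply: (@sub_finite_set _ _ (\bigcup_(i in setT) W i)).
  move=> _ [[i _ [l Ll <-]] vlK]; exists i => //; exists l => //; split=> // j.
  have : `|l| <= `|K| + `|v i|.
    rewrite -[l in leLHS](addKr (v i)); apply: le_trans (ler_normD _ _) _.
    by rewrite normrN addrC lerD2r (le_trans vlK)// ler_norm.
  by move/coord_le_norm; apply; rewrite addr_ge0.
apply: bigcup_finite => // i _; apply: finite_image.
exact: lattice_finite_bounded.
Qed.

Lemma translates_periodic p l : V p -> L l -> V (p - l).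
Proof.
have [[_ LB] _ _] := hL.
move=> [i _ [l' Ll' <-]] Ll; exists i => //; exists (l' - l); first exact: LB.
by rewrite addrA.
Qed.

(** The cells meeting [A] bound its outer measure, while the double count still holds with one more
    cell; the gap between the two numbers of cells gives strictness. *)
Lemma lebesgue_outer_lt (A : set 'rV[R]_n.+1) (m : nat) :
  A !=set0 -> closed A -> bounded_set A ->
  (forall z s, uniq s -> (forall p, p \in s -> V p /\ A (p - z)) ->
     (size s <= m)%N) ->
  exists2 a : R, (lebesgue_outer A <= a%:E)%E & a * k%:R < m%:R * lattice_det L.
Proof.
move=> [a0 Aa0] cA bA Vm.
have [[L0 LB] _ _] := hL.
have [uB LE] : is_basis L (get [set B | is_basis L B]).
  exact: getPex (lattice_basis hL).
rewrite /lattice_det; move: (get _) uB LE => B uB LE.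
have [K K0 LK] := lattice_reduction hL.
pose Q := [set z : 'rV[R]_n.+1 | forall i, z ord0 i \in `[- K, K]].
have coQ : compact Q.
  apply: (@rV_compact _ _ (fun=> `[- K, K]%classic)) => _.
  exact: segment_compact.
have bQ : bounded_set Q.
  exists K; split; first exact: num_real.
  move=> M KM z Qz; apply: le_trans (ltW KM); apply/coord_le_norm => // j.
  by rewrite ler_norml; have := Qz j; rewrite in_itv.
have [e e0 {}Vm] := count_thickening coQ bQ cA bA translates_finite_bounded Vm.
(* A cell meeting [A] and the next cell along an axis stay within [2 * d = e] of a point of [A]. *)
pose d := e / 2; have d0 : 0 < d by rewrite divr_gt0.
have /finite_seqP[S' SE] := cell_finite d0 bA.
pose S := undup S'.
have SP h : h \in S -> exists2 a, A a & cell d a = h.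
  rewrite mem_undup => hS; suff : (cell d @` A) h by case=> a; exists a.
  by rewrite SE.
have AS a : A a -> cell d a \in S.
  move=> Aa; rewrite mem_undup; suff : [set` S'] (cell d a) by [].
  by rewrite -SE; exists a.
pose u : 'rV[int]_n.+1 := delta_mx 0 0.
have [g gS guS] : exists2 g, g \in S & g + u \notin S.
  apply: exists_new_translate (AS _ Aa0) => q /rowP/(_ 0).
  by rewrite mulmxnE !mxE/=; lia.
exists ((size S)%:R * d ^+ n.+1); first exact: lebesgue_outer_cells.
suff : (size (g + u :: S))%:R * d ^+ n.+1 * k%:R <= m%:R * `|\det B|.
  apply: lt_le_trans; rewrite ltr_pM2r ?ltr0n// ltr_pM2r ?exprn_gt0//.
  by rewrite ltr_nat.
apply: (double_count uB d0).
- by rewrite /= guS undup_uniq.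
- move=> i j c vc; apply/val_inj/eqP; rewrite eqn_leq.
  have Lvv : L (v i - v j) by rewrite LE vc; exists c.
  have Lvv' : L (v j - v i) by rewrite -opprB -sub0r; exact: LB.
  by apply/andP; split; rewrite leqNgt; apply/negP => /hv.
- move=> z s us sV.
  pose zR : 'rV[R]_n.+1 := d *: map_mx intr z.
  (* Shifting by the lattice vector [l] preserves [V] and brings the translation into the compact
     set [Q], where the thickened bound holds. *)
  have [l Ll zl] := LK zR.
  rewrite -(size_map (fun p => p - l)); apply: (Vm (zR - l)).
  + by move=> i; rewrite in_itv/= -ler_norml.
  + by rewrite map_inj_uniq//; exact: addIr.
  move=> _ /mapP[p ps ->]; have [[i [c pE]] pcell] := sV p ps.
  split.
    apply: translates_periodic => //; rewrite pE; exists i => //.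
    by exists (map_mx intr c *m B) => //; rewrite LE; exists c.
  have near_cell a h : A a -> cell d a = h ->
      (forall j, d * (h 0 j)%:~R < (p - zR) 0 j <= d * (h 0 j)%:~R + d + d) ->
      exists2 a, A a & `|p - l - (zR - l) - a| <= e.
    move=> Aa ah ph; exists a => //.
    have -> : p - l - (zR - l) - a = (p - zR) - a.
      by apply/rowP => j; rewrite !mxE; ring.
    apply/coord_le_norm => [|j]; first exact: ltW.
    have := ph j; have /(_ j) := iffRL (cellP a h d0) ah.
    rewrite intrD [(_ - a) 0 j]mxE [(- a) 0 j]mxE.
    have -> : e = d + d by rewrite /d -splitr.
    move=> /andP[? ?] /andP[? ?]; rewrite ler_norml; apply/andP; split; lra.
  have pz j : d * ((cell d p - z) 0 j)%:~R < (p - zR) 0 j <=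
      d * ((cell d p - z) 0 j)%:~R + d.
    have /(_ j) := iffRL (cellP p (cell d p) d0) erefl.
    rewrite /zR; move: (cell d p) => h; rewrite !mxE intrB intrD.
    by move=> /andP[? ?]; apply/andP; split; lra.
  (* In the extra cell [g + u] the distance is measured from a point of [A] in the neighbouring cell
     [g]. *)
  move: pcell; rewrite inE => /orP[/eqP pg|/SP[a Aa ah]].
    have [a Aa ag] := SP g gS; apply: (near_cell a g) => // j.
    have := pz j; rewrite pg.
    have -> : ((g + u) 0 j)%:~R = (g 0 j)%:~R + (j == 0)%:R :> R.
      by rewrite mxE intrD mxE eqxx; case: (j == 0).
    by case: (j == 0) => /= /andP[? ?]; apply/andP; split; lra.
  apply: (near_cell a _ Aa ah) => j; have := pz j.
  by move=> /andP[? ?]; apply/andP; split; lra.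
Qed.

End UnionOfTranslates.

(** * From the strict bound to the floor inequality, and its sharpness *)

Unset Implicit Arguments.

Theorem theorem2p2 (R : realType) (n k : nat) (hn : (0 < n)%N) (hk : (0 < k)%N)
    (L : set 'rV[R]_n) (hL : is_lattice L)
    (v : 'I_k -> 'rV[R]_n)
    (hv : forall i j : 'I_k, (i < j)%N -> ~ L (v i - v j))
    (V : set 'rV[R]_n)
    (hV : V = \bigcup_(i in [set: 'I_k]) translate (v i) L) :
  (forall D : set 'rV[R]_n,
    D !=set0 -> bounded_set D -> lebesgue_measurable D ->
    exists z : 'rV[R]_n,
      ((Num.floor (vol D * k%:R / lattice_det L) + 1)%:~R%:E
        <= counting (translate z (closure D) `&` V) :> \bar R)%E)
  /\
  (exists D : set 'rV[R]_n,
    [/\ bounded_set D, lebesgue_measurable D,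
        (exists z : 'rV[R]_n,
          counting (translate z (closure D) `&` V)
          = (Num.floor (vol D * k%:R / lattice_det L) + 1)%:~R%:E :> \bar R) &
        (forall z : 'rV[R]_n,
          (counting (translate z (closure D) `&` V)
           <= (Num.floor (vol D * k%:R / lattice_det L) + 1)%:~R%:E
             :> \bar R)%E)]).
Proof.
subst V; case: n hn L hL v hv => // n _ L hL v hv.
set V := \bigcup_(i in _) _; split=> [D [a Da] bD _|].
  apply: contrapT => noz.
  (* The floor is nonnegative, so [m] equals it; if no translate reaches [m + 1] points, all have at
     most [m]. *)
  pose m := `|Num.floor (vol D * k%:R / lattice_det L)|%N.
  have detL : 0 < lattice_det L.
    rewrite normr_gt0 -unitfE -unitmxE.
    by have [] := getPex (lattice_basis hL).
  have vol0 : 0 <= vol D by rewrite fine_ge0// lebesgue_outer_ge0.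
  have mE : Num.floor (vol D * k%:R / lattice_det L) = m%:Z.
    by rewrite gez0_abs// floor_ge0 divr_ge0 ?mulr_ge0// ltW.
  have [||||b Db bk] := @lebesgue_outer_lt R n k L v hk hL hv (closure D) m.
  - by exists a; exact: subset_closure.
  - exact: closed_closure.
  - exact: bounded_closure.
  - move=> z s us sV.
    apply: (@counting_not_ge R _ (translate z (closure D) `&` V)) us _.
      move=> mle; apply: noz; exists z; rewrite mE.
      by rewrite -PoszD addn1.
    move=> p /sV[Vp Dp]; split=> //; exists (p - z) => //.
    by rewrite addrC subrK.
  (* The finite bound for the closure makes the outer measure of [D] finite, so [fine] does not fall
     back to 0. *)
  have volb : vol D <= b.
    have Db' := le_trans (le_lebesgue_outer (@subset_closure _ D)) Db.
    have Dfin : lebesgue_outer D \is a fin_num.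
      rewrite ge0_fin_numE ?lebesgue_outer_ge0//.
      exact: le_lt_trans Db' (ltry _).
    by rewrite -lee_fin /vol fineK.
  have := floor_le (vol D * k%:R / lattice_det L).
  rewrite mE ler_pdivlMr// -[m%:Z%:~R]/(m%:R) leNgt => /negP; apply.
  by apply: le_lt_trans bk; rewrite ler_wpM2r.
have cl0 : closure ([set 0] : set 'rV[R]_n.+1) = [set 0].
  apply/esym/closure_id; apply: accessible_closed_set1.
  by apply: hausdorff_accessible; exact: norm_hausdorff.
have tr0 (z : 'rV[R]_n.+1) :
    translate z (closure ([set 0] : set 'rV[R]_n.+1)) = [set z].
  by rewrite cl0 /translate image_set1 addr0.
have fl0 :
    Num.floor (vol ([set 0] : set 'rV[R]_n.+1) * k%:R / lattice_det L) + 1 = 1.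
  by rewrite /vol lebesgue_outer1 !mul0r floor0.
exists [set 0]; split.
- by exists 0; split; [exact: num_real|move=> M M0 x ->; rewrite /= normr0 ltW].
- exact: lebesgue_measurable1.
(* The volume is 0, so the bound is 1; it is attained at a point of [V], here the first [v i]. *)
- exists (v (Ordinal hk)); rewrite tr0 fl0.
  rewrite setIidl ?counting_set1// => _ ->; exists (Ordinal hk) => //.
  by exists 0; [case: hL => -[] | rewrite addr0].
- move=> z; rewrite tr0 fl0; have [Vz|nVz] := pselect (V z).
    by rewrite setIidl ?counting_set1// => _ ->.
  rewrite (_ : _ `&` _ = set0); last by apply/seteqP; split=> // _ [->].
  by rewrite /counting asboolT ?fset_set0 ?lee_fin.
Qed.
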